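(* Let $\mu,\kappa>0$, $\widehat{k}>\frac18$ and $\widetilde{\sigma}_y\in\mathbb{R}$ be such that $$0<\widetilde{\sigma}_y^2\le \frac{6}{e}\,\frac{\kappa}{\mu}\,\frac{8\widehat{k}-1}{8\widehat{k}} .$$ Then there exists $k>0$ such that, for the Cauchy stress $\sigma_{\rm eH}$ with parameters $\mu,\kappa,k,\widehat{k}$, $$\langle D_X\sigma_{\rm eH}(X).H,\,H\rangle>0\qquad\text{for all } X\in\mathcal{E}\ \text{ and all } H\in\mathrm{Sym}(3)\setminus\{0\},$$ where $\mathcal{E}=\{X\in\mathrm{Sym}(3): \|\mathrm{dev}_3X\|^2\le \frac23\widetilde{\sigma}_y^2\}$; i.e. the TSTS-M$^+$ inequality is satisfied in $\mathcal{E}$ (equivalently, in terms of the stretch $V$ with $X=\log V$, it is satisfied in $\{V\in\mathrm{PSym}(3):\|\mathrm{dev}_3\log V\|^2\le\frac23\widetilde{\sigma}_y^2\}$).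
   Context: $\mathrm{Sym}(3)$ and $\mathrm{PSym}(3)$ are the real symmetric, respectively symmetric positive definite, $3\times3$ matrices; $\langle X,Y\rangle=\mathrm{tr}(XY^T)$, $\|X\|^2=\langle X,X\rangle$, $\mathrm{dev}_3X=X-\frac13\mathrm{tr}(X)I$ with $I$ the identity matrix. For parameters $\mu,\kappa,k,\widehat{k}>0$, the Cauchy stress of the exponentiated Hencky energy $W_{\rm eH}(\log V)=\frac{\mu}{k}e^{k\|\mathrm{dev}_3\log V\|^2}+\frac{\kappa}{2\widehat{k}}e^{\widehat{k}(\mathrm{tr}\log V)^2}$ as a function of $X=\log V$ is $$\sigma_{\rm eH}(X)=2\mu\,e^{k\|\mathrm{dev}_3 X\|^2-\mathrm{tr}(X)}\,\mathrm{dev}_3 X+\kappa\,e^{\widehat{k}[\mathrm{tr}(X)]^2-\mathrm{tr}(X)}\,\mathrm{tr}(X)\, I.$$ TSTS-M$^+$ (true-stress-true-strain monotonicity) is strict monotonicity of the Cauchy stress as a function of the logarithmic strain: $\langle\sigma_{\rm eH}(X_1)-\sigma_{\rm eH}(X_2),X_1-X_2\rangle>0$ for $X_1\ne X_2$. *)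

(* Defs.v *)
From HB Require Import structures.
From mathcomp Require Import all_boot all_order all_algebra.
From mathcomp Require Import all_classical all_reals all_analysis.
Set Implicit Arguments.
Unset Strict Implicit.
Unset Printing Implicit Defensive.
Import Order.TTheory GRing.Theory Num.Theory.
Import numFieldNormedType.Exports.
Local Open Scope classical_set_scope.
Local Open Scope ring_scope.

(* [`|X|] on matrices is the sup norm in MathComp-Analysis, so the Frobenius
   norm is always written through this inner product. *)
Definition frob (R : realType) (n : nat) (X Y : 'M[R]_n) : R :=
  \tr (X *m Y^T).

Definition Sym (R : realType) (n : nat) : set 'M[R]_n := [set X | X^T = X].

Definition PSym (R : realType) (n : nat) : set 'M[R]_n :=
  [set V | Sym V /\
           forall x : 'cV[R]_n, x != 0 -> 0 < (x^T *m V *m x) 0 0].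

Definition dev3 (R : realType) (X : 'M[R]_3) : 'M[R]_3 :=
  X - (3^-1 * \tr X) *: 1%:M.

(* Principal logarithm of a symmetric positive definite matrix, by its spectral
   decomposition; the result depends neither on the choice of [Q] nor on that
   of [d].  Outside [PSym] the value is 0. *)
Definition mxlog (R : realType) (n : nat) (V : 'M[R]_n) : 'M[R]_n :=
  xget 0 [set X | exists (Q : 'M[R]_n) (d : 'rV[R]_n),
    [/\ Q *m Q^T = 1%:M, (forall i, 0 < d 0 i),
        V = Q^T *m diag_mx d *m Q
      & X = Q^T *m diag_mx (map_mx (@ln R) d) *m Q]].

(* The formula is used on all 3 x 3 matrices: Sym(3) is a linear subspace that
   is mapped into itself, so the Fréchet differential at a symmetric matrix,
   applied to symmetric increments, is the differential on Sym(3). *)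
Definition sigma_eH (R : realType) (mu kappa k khat : R) (X : 'M[R]_3) :
    'M[R]_3 :=
  (2 * mu * expR (k * frob (dev3 X) (dev3 X) - \tr X)) *: dev3 X
  + (kappa * expR (khat * (\tr X) ^+ 2 - \tr X) * \tr X) *: 1%:M.

Definition TSTS_Mplus (R : realType) (sigma : 'M[R]_3 -> 'M[R]_3)
    (E : set 'M[R]_3) : Prop :=
  forall X1 X2, E X1 -> E X2 -> X1 <> X2 ->
    0 < frob (sigma X1 - sigma X2) (X1 - X2).

Definition TSTS_Mplus_stretch (R : realType) (sigma : 'M[R]_3 -> 'M[R]_3)
    (E : set 'M[R]_3) : Prop :=
  forall V1 V2, E V1 -> E V2 -> V1 <> V2 ->
    0 < frob (sigma (mxlog V1) - sigma (mxlog V2)) (mxlog V1 - mxlog V2).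

Definition pos_differential (R : realType) (sigma : 'M[R]_3 -> 'M[R]_3)
    (X : 'M[R]_3) : Prop :=
  differentiable sigma X /\
  forall H, Sym H -> H <> 0 -> 0 < frob ('d sigma X H) H.

Definition elastic_strain (R : realType) (sy : R) : set 'M[R]_3 :=
  [set X | Sym X /\ frob (dev3 X) (dev3 X) <= 2 / 3 * sy ^+ 2].

Definition elastic_stretch (R : realType) (sy : R) : set 'M[R]_3 :=
  [set V | PSym V /\
           frob (dev3 (mxlog V)) (dev3 (mxlog V)) <= 2 / 3 * sy ^+ 2].

(* Main.v *)
Require Import Defs.
From HB Require Import structures.
From mathcomp Require Import all_boot all_order all_algebra.
From mathcomp Require Import all_classical all_reals all_analysis.
From mathcomp Require Import ring lra complex spectral.
Import Order.TTheory GRing.Theory Num.Theory.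
Import numFieldNormedType.Exports.
Local Open Scope classical_set_scope.
Local Open Scope ring_scope.

(** Write [D = dev3 X], [h = dev3 H], [t = \tr X], [s = \tr H], [p = <D, h>].
    Because [D] is orthogonal to the identity matrix, differentiating the
    stress gives ([frob_diff_sigma])
      [e^t <Dsigma(X).H, H> = 2 mu e^(k|D|^2) (2 k p^2 - s p + |h|^2)
                            + kappa e^(khat t^2) (2 khat t^2 - t + 1) s^2],
    a quadratic form in [(p, |h|, s)].  As [e^(khat t^2) >= 1], the volumetric
    coefficient is at least [kappa g] with [g = (8 khat - 1) / (8 khat)], the minimum of
    [2 khat t^2 - t + 1].  In the deviatoric part only the mixed term [- s p]
    can be negative; by Cauchy-Schwarz [p^2 <= |D|^2 |h|^2 <= M |h|^2] with
    [M = 2/3 sy^2], so for the choice [k = 1 / (2 M)] that part is bounded below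
    by [2 p^2 / M - s p >= - M s^2 / 8] ([quadratic_pos]).  The exponential
    is then at most [e^(1/2) < e], and the assumption on [sy] says exactly that
    [mu e M <= 4 kappa g], which makes the sum positive ([sigma_pos]).

    The set of admissible strains is a sublevel set of a convex function, so
    positivity of the differential gives strict monotonicity by the mean value
    theorem along segments ([monotone_of_pos_differential]).

    The stretch formulation follows since [mxlog] takes symmetric values
    ([mxlog_sym]) and is injective on positive definite matrices
    ([mxlog_inj]).  Injectivity needs every such matrix to have a logarithm,
    that is, the spectral theorem for real symmetric matrices ([sym_spectral]):
    a real eigenvector comes from the complex spectral theorem, a Householder
    reflection moves it to the first basis vector, and one inducts on the
    dimension. *)

Set Implicit Arguments.
Unset Strict Implicit.
Unset Printing Implicit Defensive.

(** * Differentials of maps on matrices *)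

Lemma linear_mx_continuous (R : realType) m n (W : normedModType R)
  (f : {linear 'M[R]_(m, n) -> W}) : continuous f.
Proof.
have -> : (f : 'M[R]_(m, n) -> W) =
    \sum_i \sum_j (fun X : 'M[R]_(m, n) => X i j *: f (delta_mx i j)).
  apply/funext => X; rewrite [X in f X]matrix_sum_delta linear_sum fct_sumE.
  apply: eq_bigr => i _; rewrite linear_sum fct_sumE.
  by apply: eq_bigr => j _; rewrite linearZ.
pose P (g : 'M[R]_(m, n) -> W) := continuous g.
have PD (g h : 'M[R]_(m, n) -> W) : P g -> P h -> P (g + h).
  by move=> cg ch X; exact: (continuousD (cg X) (ch X)).
have P0 : P 0 by exact: cst_continuous.
apply: (big_ind P) => // i _; apply: (big_ind P) => // j _ X.
by apply: continuousZr_tmp; have := @coord_continuous R m n i j X.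
Qed.

Lemma is_diff_linear_mx (R : realType) m n (W : normedModType R)
  (f : {linear 'M[R]_(m, n) -> W}) X : is_diff X f f.
Proof.
have fc := @linear_mx_continuous _ _ _ _ f.
by apply: DiffDef; [exact: linear_differentiable|rewrite diff_lin].
Qed.

Lemma is_diff_scale (R : realType) (V W : normedModType R)
  (f df : V -> R) (g dg : V -> W) x : is_diff x f df -> is_diff x g dg ->
  is_diff x (fun y => f y *: g y) (fun v => f x *: dg v + df v *: g x).
Proof.
move=> hf hg.
have lin : bilinear_for (GRing.Scale.Law.clone _ _ *:%R _)
    (GRing.Scale.Law.clone _ _ *:%R _) (fun (a : R) (w : W) => a *: w).
  split=> [u'|u] a y z /=; first by rewrite scalerDl scalerA.
  by rewrite scalerDr !scalerA mulrC.
pose B : {bilinear R -> W -> W} := HB.pack (fun (a : R) (w : W) => a *: w)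
  (bilinear_isBilinear.Build R R W W _ _ _ lin).
have Bc : continuous (fun p : R * W => B p.1 p.2) by exact: scale_continuous.
have hB p : is_diff p (fun p : R * W => B p.1 p.2)
    (fun q => p.1 *: q.2 + q.1 *: p.2).
  by apply: DiffDef; [exact: differentiable_bilin|exact: (diff_bilin _ Bc)].
exact: (is_diff_comp (is_diff_pair hf hg) (hB (f x, g x))).
Qed.

Lemma is_diff_expR (R : realType) (x : R) :
  is_diff x expR (fun h => expR x * h).
Proof.
apply: DiffDef; first exact/derivable1_diffP/derivable_expR.
apply/funext => h; rewrite diff1E; last exact/derivable1_diffP/derivable_expR.
by rewrite derive1E derive_val mulrC.
Qed.

(** * The Frobenius inner product and the deviator *)

Lemma frob_sum (R : realType) n (X Y : 'M[R]_n) :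
  frob X Y = \sum_i \sum_j X i j * Y i j.
Proof.
rewrite /frob /mxtrace; apply: eq_bigr => i _.
by rewrite mxE; apply: eq_bigr => j _; rewrite mxE.
Qed.

Lemma frobC (R : realType) n (X Y : 'M[R]_n) : frob X Y = frob Y X.
Proof. by rewrite /frob -mxtrace_tr trmx_mul trmxK. Qed.

Lemma frob_bilinear (R : realType) n :
  bilinear_for (GRing.Scale.Law.clone _ _ *:%R _)
    (GRing.Scale.Law.clone _ _ *:%R _) (@frob R n).
Proof.
split=> [Y|X] a U V /=; rewrite /frob.
  by rewrite mulmxDl -scalemxAl linearP.
by rewrite linearP /= mulmxDr -scalemxAr linearP.
Qed.

HB.instance Definition _ (R : realType) n := bilinear_isBilinear.Build
  R 'M[R]_n 'M[R]_n R _ _ (@frob R n) (frob_bilinear R n).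

Lemma frobDl (R : realType) n (X Y Z : 'M[R]_n) :
  frob (X + Y) Z = frob X Z + frob Y Z.
Proof. exact: linearDl. Qed.

Lemma frobZl (R : realType) n a (X Z : 'M[R]_n) :
  frob (a *: X) Z = a * frob X Z.
Proof. exact: linearZl_LR. Qed.

Lemma frob_ge0 (R : realType) n (X : 'M[R]_n) : 0 <= frob X X.
Proof.
rewrite frob_sum; apply: sumr_ge0 => i _; apply: sumr_ge0 => j _.
by rewrite -expr2 sqr_ge0.
Qed.

Lemma frob_eq0 (R : realType) n (X : 'M[R]_n) : (frob X X == 0) = (X == 0).
Proof.
apply/eqP/eqP => [|->]; last by rewrite linear0r.
rewrite frob_sum => /eqP; rewrite psumr_eq0; last first.
  by move=> i _; apply: sumr_ge0 => j _; rewrite -expr2 sqr_ge0.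
move=> /allP h; apply/matrixP => i j; rewrite mxE.
have := h i (mem_index_enum _); rewrite psumr_eq0 /=; last first.
  by move=> k _; rewrite -expr2 sqr_ge0.
by move=> /allP/(_ j (mem_index_enum _))/=; rewrite mulf_eq0 orbb => /eqP.
Qed.

(** Cauchy-Schwarz, by expanding the square of the component of [X] orthogonal
    to [Y], scaled by [frob Y Y] to avoid a division. *)
Lemma frob_CS (R : realType) n (X Y : 'M[R]_n) :
  frob X Y ^+ 2 <= frob X X * frob Y Y.
Proof.
have [->|Y0] := eqVneq Y 0; first by rewrite linear0r expr0n/= linear0r mulr0.
have yy : 0 < frob Y Y by rewrite lt_def frob_eq0 Y0 frob_ge0.
have := frob_ge0 (frob Y Y *: X - frob X Y *: Y).
rewrite !linearBl !linearBr !linearZl_LR !linearZr_LR /= (frobC Y X).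
set a := frob X X; set b := frob X Y; set c := frob Y Y in yy *.
have -> : c *: (c *: a) - c *: (b *: b) - (b *: (c *: b) - b *: (b *: c))
   = c * (a * c - b ^+ 2) by rewrite /GRing.scale /=; ring.
by rewrite pmulr_rge0// subr_ge0.
Qed.

Lemma is_diff_frob (R : realType) n (V : normedModType R)
  (f df g dg : V -> 'M[R]_n) x : is_diff x f df -> is_diff x g dg ->
  is_diff x (fun y => frob (f y) (g y))
    (fun v => frob (f x) (dg v) + frob (df v) (g x)).
Proof.
move=> hf hg.
have Bc : continuous (fun p : 'M[R]_n * 'M[R]_n => frob p.1 p.2).
  have -> : (fun p : 'M[R]_n * 'M[R]_n => frob p.1 p.2) =
      \sum_i \sum_j (fun p : 'M[R]_n * 'M[R]_n => p.1 i j * p.2 i j).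
    apply/funext => p; rewrite frob_sum fct_sumE; apply: eq_bigr => i _.
    by rewrite fct_sumE.
  pose P (g : 'M[R]_n * 'M[R]_n -> R) := continuous g.
  have PD (h k : 'M[R]_n * 'M[R]_n -> R) : P h -> P k -> P (h + k).
    by move=> ch ck X; exact: (continuousD (ch X) (ck X)).
  have P0 : P 0 by exact: cst_continuous.
  apply: (big_ind P) => // i _; apply: (big_ind P) => // j _ X.
  have c := @coord_continuous R n n i j.
  have h1 : {for X, continuous (fun p : 'M[R]_n * 'M[R]_n => p.1 i j)}.
    exact: (continuous_comp (f := fst) (g := fun Z : 'M[R]_n => Z i j)
      cvg_fst (c _)).
  have h2 : {for X, continuous (fun p : 'M[R]_n * 'M[R]_n => p.2 i j)}.
    exact: (continuous_comp (f := snd) (g := fun Z : 'M[R]_n => Z i j)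
      cvg_snd (c _)).
  exact: (continuousM h1 h2).
have hB p : is_diff p (fun p : 'M[R]_n * 'M[R]_n => frob p.1 p.2)
    (fun q => frob p.1 q.2 + frob q.1 p.2).
  by apply: DiffDef; [exact: differentiable_bilin|exact: (diff_bilin _ Bc)].
exact: (is_diff_comp (is_diff_pair hf hg) (hB (f x, g x))).
Qed.

Lemma dev3_linear (R : realType) : linear (@dev3 R).
Proof.
move=> a X Y; rewrite /dev3 linearP /= mulrDr scalerDl scalerBr opprD addrACA.
by rewrite scalerA mulrCA.
Qed.

HB.instance Definition _ (R : realType) := GRing.isLinear.Build
  R 'M[R]_3 'M[R]_3 _ (@dev3 R) (@dev3_linear R).

Lemma dev3_tr (R : realType) (X : 'M[R]_3) : \tr (dev3 X) = 0.
Proof.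
rewrite /dev3 linearB /= linearZ /= mxtrace1 mulrAC mulVf ?pnatr_eq0//.
by rewrite mul1r subrr.
Qed.

(** Deviators are orthogonal to scalar matrices. *)
Lemma frob_dev3 (R : realType) (X Y : 'M[R]_3) :
  frob (dev3 X) Y = frob (dev3 X) (dev3 Y).
Proof.
rewrite {3}/dev3 linearBr linearZr_LR /= [frob _ 1%:M]/frob trmx1 mulmx1.
by rewrite dev3_tr scaler0 subr0.
Qed.

(** * The differential of the Cauchy stress *)

Lemma is_diff_sigma (R : realType) (mu kappa k khat : R) (X : 'M[R]_3) :
  let t := \tr X in let D := dev3 X in
  is_diff X (sigma_eH mu kappa k khat) (fun H =>
    (2 * mu * expR (k * frob D D - t)) *:
      (dev3 H + (2 * k * frob D (dev3 H) - \tr H) *: D)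
    + (kappa * expR (khat * t ^+ 2 - t) *
       ((2 * khat * t - 1) * t + 1) * \tr H) *: 1%:M).
Proof.
move=> t D.
have dT : is_diff X (@mxtrace R 3) (@mxtrace R 3) by exact: is_diff_linear_mx.
have dD : is_diff X (@dev3 R) (@dev3 R) by exact: is_diff_linear_mx.
have dN := is_diff_frob dD dD.
have d1 := is_diff_comp (is_diffB (is_diffZ k dN) dT) (is_diff_expR _).
have d2 := is_diff_comp (is_diffB (is_diffZ khat (is_diffX 1 dT)) dT)
  (is_diff_expR _).
have dA := is_diff_scale (is_diffZ (2 * mu) d1) dD.
have dB := is_diff_scale (is_diffM (is_diffZ kappa d2) dT)
  (is_diff_cst (1%:M : 'M[R]_3) X).
have dS := is_diffD dA dB.
(* the point-free shape in which the rules above assemble the map *)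
have -> : sigma_eH mu kappa k khat =
  (fun Y => (2 * mu *: (expR \o (k *: (fun y => frob (dev3 y) (dev3 y))
      - mxtrace (n:=3)))) Y *: dev3 Y) +
  (fun Y => (kappa *: (expR \o (khat *: mxtrace (n:=3) ^+ 2 - mxtrace (n:=3)))
      * mxtrace (n:=3)) Y *: (1%:M : 'M[R]_3)) by [].
apply: is_diff_eq dS _; apply/funext => H.
set E1 := expR (k * frob D D - t); set E2 := expR (khat * t ^+ 2 - t).
transitivity ((2 * mu * E1) *: dev3 H +
   (2 * mu * (E1 * (k * (frob D (dev3 H) + frob (dev3 H) D) - \tr H))) *: D +
   ((kappa * E2 * t) *: (0 : 'M[R]_3) + (kappa * E2 * \tr H +
    t * (kappa * (E2 * (khat * (2 * t ^+ 1 * \tr H) - \tr H)))) *: 1%:M)).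
  by [].
rewrite scaler0 add0r (frobC _ D); move: (dev3 H) => h.
rewrite (scalerDr (2 * mu * E1) h) scalerA.
by congr (_ + _ *: _ + _ *: _); ring.
Qed.

Lemma frob_diff_sigma (R : realType) (mu kappa k khat : R) (X H : 'M[R]_3) :
  let t := \tr X in let s := \tr H in let D := dev3 X in let h := dev3 H in
  frob ('d (sigma_eH mu kappa k khat) X H) H = expR (- t) *
    (2 * mu * expR (k * frob D D) *
       (2 * k * frob D h ^+ 2 - s * frob D h + frob h h)
     + kappa * expR (khat * t ^+ 2) * (2 * khat * t ^+ 2 - t + 1) * s ^+ 2).
Proof.
move=> t s D h.
have [_ ->] := is_diff_sigma mu kappa k khat X.
rewrite frobDl 2!frobZl frobDl frobZl -/D -/h -/t -/s.
rewrite (frob_dev3 H) (frob_dev3 X H) -/D -/h.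
have -> : frob 1%:M H = s by rewrite /frob mul1mx mxtrace_tr.
by rewrite !expRD; ring.
Qed.

(** * Positivity of the differential *)

(** Since [N >= p^2 / M], the form dominates
    [A (2 p^2 / M - s p) + K s^2], whose discriminant in [p] is negative for
    [s != 0] as soon as [A M < 8 K]; for [s = 0] the term [A N] is positive. *)
Lemma quadratic_pos (R : realType) (A K M k p d N s : R) :
  0 < M -> 2 * k = M^-1 -> 0 < A -> A * M < 8 * K ->
  0 <= N -> p ^+ 2 <= d * N -> d <= M -> (N = 0 -> s != 0) ->
  0 < A * (2 * k * p ^+ 2 - s * p + N) + K * s ^+ 2.
Proof.
move=> M0 kM A0 AK N0 pd dM Ns.
have pM : p ^+ 2 / M <= N.
  by rewrite ler_pdivrMr// mulrC (le_trans pd)// ler_wpM2r.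
rewrite kM.
have [s0|s0] := eqVneq s 0.
  have N1 : 0 < N.
    by rewrite lt_def N0 andbT; apply/eqP => /Ns; rewrite s0 eqxx.
  rewrite s0 expr0n/= mulr0 addr0 mul0r subr0 mulr_gt0// ltr_wpDl//.
  by rewrite mulr_ge0// ?sqr_ge0// invr_ge0 ltW.
pose Q := A * (M^-1 * p ^+ 2 - s * p + p ^+ 2 / M) + K * s ^+ 2.
have QE : Q = 2 * A / M * (p - M * s / 4) ^+ 2
              + (8 * K - A * M) / 8 * s ^+ 2.
  by rewrite /Q; field; rewrite gt_eqF.
apply: (@lt_le_trans _ _ Q).
  rewrite QE ltr_wpDl//.
    by rewrite mulr_ge0 ?sqr_ge0// divr_ge0 ?ltW// mulr_gt0.
  by rewrite mulr_gt0 ?exprn_even_gt0// divr_gt0// subr_gt0.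
by rewrite lerD2r ler_wpM2l ?lerD2l// ltW.
Qed.

(** The parameter [k = 1 / (2 M)] with [M = 2/3 sy^2] keeps [k |D|^2] below
    [1/2], so that the exponential stays below [e], while the term
    [2 k p^2 = p^2 / M] contributes as much as [|h|^2] does. *)
Lemma sigma_pos (R : realType) (mu kappa khat sy : R)
    (hmu : 0 < mu) (hkappa : 0 < kappa) (hkhat : 1 / 8 < khat)
    (hsy0 : 0 < sy ^+ 2)
    (hsy : sy ^+ 2 <=
       6 / expR 1 * (kappa / mu) * ((8 * khat - 1) / (8 * khat))) X :
  elastic_strain sy X ->
  pos_differential (sigma_eH mu kappa (2 * (2 / 3 * sy ^+ 2))^-1 khat) X.
Proof.
move=> [_ dX]; split.
  exact: (@ex_diff _ _ _ _ _ _ _ (is_diff_sigma _ _ _ _ _)).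
move=> H _ H0; rewrite frob_diff_sigma mulr_gt0 ?expR_gt0//.
set M := 2 / 3 * sy ^+ 2 in dX *.
have M0 : 0 < M by rewrite mulr_gt0.
set d := frob (dev3 X) (dev3 X) in dX *.
have khat0 : 0 < khat by apply: lt_trans hkhat.
set t := \tr X; set g := (8 * khat - 1) / (8 * khat) in hsy.
have g0 : 0 < g by rewrite divr_gt0 ?mulr_gt0// subr_gt0; lra.
have M2 : 0 < 2 * M by lra.
apply: (@quadratic_pos _ _ _ M _ _ d) => //.
- by rewrite invfM mulrA divff ?mul1r// pnatr_eq0.
- by rewrite !mulr_gt0 ?expR_gt0.
- have e1 : expR ((2 * M)^-1 * d) < expR 1.
    rewrite ltr_expR [_ * d]mulrC ltr_pdivrMr//; lra.
  have e2 : g <= expR (khat * t ^+ 2) * (2 * khat * t ^+ 2 - t + 1).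
    have h1 : g <= 2 * khat * t ^+ 2 - t + 1.
      have -> : 2 * khat * t ^+ 2 - t + 1 =
          2 * khat * (t - 1 / (4 * khat)) ^+ 2 + g.
        by rewrite /g; field; rewrite gt_eqF.
      by rewrite lerDr mulr_ge0 ?sqr_ge0// mulr_ge0// ltW.
    apply: (le_trans h1); apply: ler_peMl; first exact: le_trans (ltW g0) h1.
    by rewrite -expR0 ler_expR mulr_ge0 ?sqr_ge0// ltW.
  have e3 : mu * expR 1 * M <= 4 * (kappa * g).
    have -> : 4 * (kappa * g) =
        mu * expR 1 * (2 / 3 * (6 / expR 1 * (kappa / mu) * g)).
      by field; rewrite !gt_eqF// expR_gt0.
    by rewrite ler_wpM2l ?mulr_ge0 ?expR_ge0 ?(ltW hmu)// /M ler_wpM2l.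
  rewrite -[X in _ < 8 * X]mulrA; set G := expR (khat * _) * _ in e2 *.
  have : mu * expR ((2 * M)^-1 * d) * M < mu * expR 1 * M.
    by rewrite ltr_pM2r// ltr_pM2l.
  have : kappa * g <= kappa * G by rewrite ler_wpM2l// ltW.
  have -> : 2 * mu * expR ((2 * M)^-1 * d) * M =
    2 * (mu * expR ((2 * M)^-1 * d) * M) by ring.
  (* the remaining inequality is linear in these four products *)
  move: e3; move: (kappa * g) (kappa * G) (mu * expR 1 * M)
    (mu * expR ((2 * M)^-1 * d) * M).
  by move=> a b u v; lra.
- exact: frob_ge0.
- exact: frob_CS.
move=> /eqP; rewrite frob_eq0 => /eqP h0; apply/eqP => s0; apply: H0.
by move: h0; rewrite /dev3 s0 mulr0 scale0r subr0.
Qed.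

(** * From the differential to monotonicity *)

(** Apply the mean value theorem to [t |-> frob (sigma (X2 + t *: H)) H] with
    [H = X1 - X2] between [0] and [1]. *)
Lemma monotone_of_pos_differential (R : realType)
    (sigma : 'M[R]_3 -> 'M[R]_3) (E : set 'M[R]_3) :
  (forall X Y (t : R), E X -> E Y -> 0 <= t <= 1 -> E (Y + t *: (X - Y))) ->
  E `<=` @Sym R 3 ->
  (forall X, E X -> pos_differential sigma X) -> TSTS_Mplus sigma E.
Proof.
move=> cE sE dE X1 X2 E1 E2 X12.
pose H : 'M[R]_3 := X1 - X2.
have H0 : H <> 0 by move=> /eqP; rewrite subr_eq0 => /eqP.
have sH : Sym H by rewrite /Sym /= linearB /= (sE _ E1) (sE _ E2).
pose x (t : R) : 'M[R]_3 := X2 + t *: H.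
pose phi t := frob (sigma (x t)) H.
have dphi (t : R) : 0 <= t <= 1 ->
    is_diff t phi (fun h => frob ('d sigma (x t) (h *: H)) H).
  move=> t01; have [dS _] := dE _ (cE _ _ _ E1 E2 t01).
  have dx : is_diff t x (fun h => h *: H).
    apply: is_diff_eq (is_diffD (is_diff_cst X2 t) (is_diff_scalel t H)) _.
    by apply/funext => h; rewrite /GRing.add /= add0r.
  have d1 := is_diff_comp dx (differentiableP dS).
  apply: is_diff_eq (is_diff_frob d1 (is_diff_cst H t)) _.
  by apply/funext => h /=; rewrite linear0r add0r.
have dphi' (t : R) : 0 <= t <= 1 ->
    is_derive t 1 phi (frob ('d sigma (x t) H) H).
  move=> t01; have [dp dv] := dphi t t01.
  apply: DeriveDef; first exact/derivable1_diffP.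
  by rewrite deriveE// dv scale1r.
have [] := @MVT R phi (fun t => frob ('d sigma (x t) H) H) 0 1 ltr01.
- by move=> t /[!in_itv]/= /andP[t0 t1]; apply: dphi'; rewrite !ltW.
- apply: continuous_in_subspaceT => t; rewrite inE /= in_itv /= => t01.
  exact/differentiable_continuous/(ex_diff (is_diff_def := dphi t t01)).
move=> c /[!in_itv]/= /andP[c0 c1].
have xH : X2 + H = X1 by rewrite addrC subrK.
rewrite /phi /x scale1r scale0r addr0 xH subr0 mulr1 => e.
rewrite linearBl /= -/H e.
have c01 : 0 <= c <= 1 by rewrite !ltW.
by have [_] := dE _ (cE _ _ c E1 E2 c01); apply.
Qed.

Lemma convex_elastic_strain (R : realType) (sy : R) X Y (t : R) :
  elastic_strain sy X -> elastic_strain sy Y -> 0 <= t <= 1 ->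
  elastic_strain sy (Y + t *: (X - Y)).
Proof.
move=> [sX dX] [sY dY] /andP[t0 t1]; split.
  by rewrite /Sym /= linearD linearZ linearB /= sX sY.
rewrite linearD linearZ linearB /=.
set U := dev3 X in dX *; set W := dev3 Y in dY *; clearbody U W.
have -> : frob (W + t *: (U - W)) (W + t *: (U - W)) =
   t * frob U U + (1 - t) * frob W W - t * (1 - t) * frob (U - W) (U - W).
  have frobDr (A B C : 'M[R]_3) : frob A (B + C) = frob A B + frob A C.
    exact: linearDr.
  have frobZr a (A B : 'M[R]_3) : frob A (a *: B) = a * frob A B.
    exact: linearZr_LR.
  by rewrite -(scaleN1r W) !(frobDl, frobZl, frobDr, frobZr) (frobC W U); ring.
have := mulr_ge0 (mulr_ge0 t0 (_ : 0 <= 1 - t)) (frob_ge0 (U - W)).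
rewrite subr_ge0 => /(_ t1).
have := ler_wpM2l t0 dX; have := @ler_wpM2l _ (1 - t) _ _ _ dY.
rewrite subr_ge0 => /(_ t1); lra.
Qed.

(** * The spectral theorem for real symmetric matrices *)

Local Notation dot u v := ((u *m v^T) 0 0).

Lemma dot_gt0 (R : realType) n (v : 'rV[R]_n) : v != 0 -> 0 < dot v v.
Proof.
move=> v0; have [i vi] : exists i, v 0 i != 0.
  apply/existsP; apply: contra_neqT v0 => /existsPn h.
  by apply/rowP => i; rewrite mxE; apply/eqP; have := h i; rewrite negbK.
rewrite mxE (bigD1 i)//= mxE -expr2 ltr_pwDl ?exprn_even_gt0//.
by apply: sumr_ge0 => j _; rewrite mxE -expr2 sqr_ge0.
Qed.

(** Over the complex numbers the matrix is Hermitian, so its eigenvalues are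
    real; a real root of the characteristic polynomial then has an eigenvector
    over the reals. *)
Lemma sym_eigenvector (R : realType) n (A : 'M[R]_n.+1) : A^T = A ->
  exists (a : R) (v : 'rV_n.+1), v != 0 /\ v *m A = a *: v.
Proof.
move=> sA.
pose f : {rmorphism R -> R[i]%C} := real_complex R.
pose B := map_mx f A.
have hB : B \is hermsymmx.
  apply: realsym_hermsym.
    by apply/is_hermitianmxP; rewrite expr0 scale1r map_mx_id// /B map_trmx sA.
  by apply/mxOverP => i j; rewrite mxE; apply/CrealP; exact: conjc_real.
have /mxOverP/(_ 0 0) := hermitian_spectral_diag_real hB.
have /orthomx_spectralP := hermitian_normalmx hB.
set P := spectralmx B; set d := spectral_diag B => BE d0.
have uP : P \in unitmx := spectral_unit B.
have PB : row 0 P *m B = d 0 0 *: row 0 P.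
  rewrite -row_mul BE !mulmxA mulmxV// mul1mx row_mul row_diag_mx.
  by rewrite -scalemxAl -rowE.
pose a := complex.Re (d 0 0).
have ad : d 0 0 = f a by rewrite /f /= RRe_real.
have : eigenvalue A a.
  rewrite eigenvalue_root_char -(fmorph_root f) map_char_poly -/B -ad.
  rewrite -eigenvalue_root_char; apply/eigenvalueP; exists (row 0 P) => //.
  apply/eqP => P0; have /(congr1 (row 0)) := mulmxV uP.
  rewrite row_mul P0 mul0mx => /rowP/(_ 0); rewrite !mxE eqxx => /eqP.
  by rewrite eq_sym oner_eq0.
by move/eigenvalueP => [v ? ?]; exists a, v.
Qed.

(** For a unit vector [u] different from the first basis vector [e], take the
    reflection across the hyperplane orthogonal to [w = u - e]: it exchanges
    [e] and [u] because both have norm 1. *)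
Lemma householder (R : realType) n (u : 'rV[R]_n.+1) : dot u u = 1 ->
  exists (Q : 'M[R]_n.+1), [/\ Q^T = Q, Q *m Q = 1%:M & row 0 Q = u].
Proof.
move=> u1; pose e : 'rV[R]_n.+1 := delta_mx 0 0; pose w := u - e.
have [w0|w0] := eqVneq w 0.
  exists 1%:M; split; rewrite ?trmx1 ?mulmx1// row1.
  by apply/esym/eqP; rewrite -subr_eq0; apply/eqP.
have ww : dot w w != 0 by rewrite gt_eqF// dot_gt0.
pose c := 2 / dot w w.
pose W := w^T *m w.
have WW : W *m W = dot w w *: W.
  rewrite /W mulmxA -(mulmxA w^T) [X in _ *m X *m _]mx11_scalar.
  by rewrite mul_mx_scalar -scalemxAl.
exists (1%:M - c *: W); split.
- by rewrite linearB /= trmx1 linearZ /= /W trmx_mul trmxK.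
- rewrite mulmxBl mul1mx mulmxBr mulmx1 -scalemxAl -scalemxAr WW !scalerA.
  have -> : c * c * dot w w = c + c.
    by rewrite -mulrA divfK// mulr_natr mulr2n.
  by rewrite scalerDl opprB addrK subrK.
have eu : dot e u = u 0 0 by rewrite -rowE !mxE.
have ee : dot e e = 1 by rewrite -rowE !mxE.
have ue : dot u e = u 0 0.
  by rewrite -eu -[u *m e^T]trmxK trmx_mul trmxK mxE.
have wwE : dot w w = - 2 * dot e w.
  have -> : dot w w = dot u u - dot u e - dot e u + dot e e.
    by rewrite /w linearB /= mulmxBl !mulmxBr !mxE; ring.
  have -> : dot e w = dot e u - dot e e.
    by rewrite /w linearB /= mulmxBr !mxE.
  by rewrite ue eu ee u1; ring.
have ew0 : dot e w != 0 by apply: contra_neq ww => h; rewrite wwE h mulr0.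
rewrite rowE mulmxBr mulmx1 -/e -scalemxAr /W mulmxA [e *m w^T]mx11_scalar.
rewrite mul_scalar_mx scalerA.
have -> : c * dot e w = -1 by rewrite /c wwE; field.
by rewrite scaleN1r opprK addrC subrK.
Qed.

(** A reflection carrying an eigenvector to the first basis vector conjugates
    the matrix to a symmetric one whose first row, hence first column, vanishes
    off the diagonal; the remaining block is treated by induction. *)
Theorem sym_spectral (R : realType) n (A : 'M[R]_n) : A^T = A ->
  exists (Q : 'M[R]_n) (d : 'rV[R]_n),
    Q *m Q^T = 1%:M /\ A = Q^T *m diag_mx d *m Q.
Proof.
elim: n A => [|n IH] A sA.
  by exists 1%:M, 0; split; [rewrite trmx1 mulmx1|apply/matrixP => -[]].
have [a [v [v0 vA]]] := sym_eigenvector sA.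
pose u := (Num.sqrt (dot v v))^-1 *: v.
have vv := dot_gt0 v0.
have u1 : dot u u = 1.
  rewrite /u linearZ /= -scalemxAl -scalemxAr scalerA mxE -expr2 exprVn.
  by rewrite sqr_sqrtr ?ltW// mulVf// gt_eqF.
have uA : u *m A = a *: u by rewrite -scalemxAl vA !scalerA mulrC.
have [Q [Qs QQ Q0]] := householder u1.
pose B : 'M[R]_(1 + n) := Q *m A *m Q.
have sB : B^T = B by rewrite /B !trmx_mul sA Qs mulmxA.
have B0 : row 0 B = a *: delta_mx 0 0.
  rewrite !row_mul Q0 uA -scalemxAl; congr (_ *: _).
  by rewrite -Q0 -row_mul QQ row1.
have AE : A = Q *m B *m Q.
  by rewrite /B !mulmxA QQ mul1mx -mulmxA QQ mulmx1.
clearbody B.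
have sC : (drsubmx B)^T = drsubmx B by rewrite trmx_drsub sB.
have [P [d [PP BE]]] := IH _ sC.
have ur : ursubmx B = 0.
  apply/matrixP => i j; rewrite !mxE (ord1 i).
  have /rowP/(_ (rshift 1 j)) := B0; move=> h.
  transitivity (B 0 (rshift 1 j)); last by move: h; rewrite !mxE /= mulr0.
  by congr (B _ _); apply/val_inj.
have ul : ulsubmx B = a%:M.
  apply/matrixP => i j; rewrite !mxE (ord1 i) (ord1 j).
  have /rowP/(_ 0) := B0; move=> h.
  transitivity (B 0 0); last by move: h; rewrite !mxE /= mulr1 mulr1n.
  by congr (B _ _); apply/val_inj.
have dl : dlsubmx B = 0 by rewrite -sB -trmx_ursub ur trmx0.
have BB : B = block_mx a%:M 0 0 (drsubmx B) by rewrite -ul -ur -dl submxK.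
pose P' : 'M[R]_(1 + n) := block_mx 1%:M 0 0 P.
pose d' : 'rV[R]_(1 + n) := row_mx a%:M d.
have PP' : P' *m P'^T = 1%:M.
  rewrite /P' tr_block_mx mulmx_block !trmx0 !mulmx0 !mul0mx !addr0 add0r PP.
  by rewrite trmx1 mulmx1 -scalar_mx_block.
have BE' : B = P'^T *m diag_mx d' *m P'.
  rewrite BB BE diag_mx_row /P' tr_block_mx !mulmx_block !trmx0.
  rewrite !(mulmx0, mul0mx, addr0, add0r) trmx1 mulmx1 mul1mx.
  by congr block_mx; apply/matrixP => i j; rewrite !mxE !ord1.
exists (P' *m Q), d'; split.
  by rewrite trmx_mul Qs mulmxA -(mulmxA P') QQ mulmx1.
by rewrite AE trmx_mul Qs BE' !mulmxA.
Qed.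

(** * Injectivity of the principal logarithm *)

(** Two spectral decompositions of [f]-images agree iff the transition matrix
    [M = Q P^T] satisfies [f (d i) M i j = M i j f (e j)], i.e. iff [M] links
    only indices with [f (d i) = f (e j)].  Hence a function that factors
    through [f] on the two spectra also has a well-defined matrix value. *)
Lemma spectral_calculus_eq (R : realType) n (f g : R -> R)
    (Q P : 'M[R]_n) (d e : 'rV[R]_n) :
  Q *m Q^T = 1%:M -> P *m P^T = 1%:M ->
  (forall i j, f (d 0 i) = f (e 0 j) -> g (d 0 i) = g (e 0 j)) ->
  Q^T *m diag_mx (map_mx f d) *m Q = P^T *m diag_mx (map_mx f e) *m P ->
  Q^T *m diag_mx (map_mx g d) *m Q = P^T *m diag_mx (map_mx g e) *m P.
Proof.
move=> hQ hP fg E.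
have hQ' := mulmx1C hQ; have hP' := mulmx1C hP.
pose M := Q *m P^T.
have ME h :
    Q^T *m diag_mx (map_mx h d) *m Q = P^T *m diag_mx (map_mx h e) *m P
    <-> diag_mx (map_mx h d) *m M = M *m diag_mx (map_mx h e).
  split=> [/(congr1 (fun Z => Q *m Z *m P^T))|H].
    by rewrite !mulmxA hQ mul1mx -!mulmxA hP mulmx1 !mulmxA.
  have /(congr1 (fun Z => Q^T *m Z *m P)) := H.
  by rewrite /M !mulmxA hQ' mul1mx -!mulmxA hP' mulmx1.
apply/ME; move/ME: E => E; apply/matrixP => i j.
have /matrixP/(_ i j) := E.
rewrite !mul_diag_mx !mul_mx_diag !mxE => /eqP.
rewrite mulrC -subr_eq0 -mulrBr mulf_eq0 => /orP[/eqP->|].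
  by rewrite mulr0 mul0r.
by rewrite subr_eq0 => /eqP /fg ->; rewrite mulrC.
Qed.

Lemma mxlogP (R : realType) n (V : 'M[R]_n) : PSym V ->
  exists (Q : 'M[R]_n) (d : 'rV[R]_n),
    [/\ Q *m Q^T = 1%:M, (forall i, 0 < d 0 i),
        V = Q^T *m diag_mx d *m Q
      & mxlog V = Q^T *m diag_mx (map_mx (@ln R) d) *m Q].
Proof.
move=> [sV pV]; have [Q [d [hQ VE]]] := sym_spectral sV.
apply: (@xgetPex _ 0 [set X | exists (Q : 'M[R]_n) (d : 'rV[R]_n),
    [/\ Q *m Q^T = 1%:M, (forall i, 0 < d 0 i),
        V = Q^T *m diag_mx d *m Q
      & X = Q^T *m diag_mx (map_mx (@ln R) d) *m Q]]).
exists (Q^T *m diag_mx (map_mx (@ln R) d) *m Q), Q, d; split=> // i.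
have ri0 : (row i Q)^T != 0.
  rewrite trmx_eq0; apply/eqP => r0; have /(congr1 (row i)) := hQ.
  rewrite row_mul r0 mul0mx => /rowP/(_ i); rewrite !mxE eqxx => /eqP.
  by rewrite eq_sym oner_eq0.
(* the quadratic form of V at the i-th row of Q is the i-th eigenvalue *)
have := pV _ ri0; rewrite trmxK VE rowE trmx_mul !mulmxA.
rewrite -(mulmxA _ Q) hQ mulmx1 -(mulmxA _ Q) hQ mulmx1.
rewrite -rowE row_diag_mx -scalemxAl trmx_delta mul_delta_mx.
by rewrite !mxE !eqxx mulr1.
Qed.

Lemma mxlog_inj (R : realType) n (V W : 'M[R]_n) : PSym V -> PSym W ->
  mxlog V = mxlog W -> V = W.
Proof.
move=> /mxlogP[Q [d [hQ d0 -> ->]]] /mxlogP[P [e [hP e0 -> ->]]].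
rewrite -{2}[d](@map_mx_id _ _ _ id)// -{2}[e](@map_mx_id _ _ _ id)//.
apply: spectral_calculus_eq => // i j.
by apply: ln_inj; rewrite posrE; [exact: d0|exact: e0].
Qed.

Lemma mxlog_sym (R : realType) n (V : 'M[R]_n) : Sym (mxlog V).
Proof.
rewrite /Sym /mxlog /=; case: xgetP => [X -> [Q [d [_ _ _ ->]]]|_].
  by rewrite !trmx_mul trmxK tr_diag_mx mulmxA.
by rewrite trmx0.
Qed.

(** * Monotonicity in the elastic range *)

Theorem proposition4p6 (R : realType) (mu kappa khat sy : R)
    (hmu : 0 < mu) (hkappa : 0 < kappa) (hkhat : 1 / 8 < khat)
    (hsy0 : 0 < sy ^+ 2)
    (hsy : sy ^+ 2 <=
       6 / expR 1 * (kappa / mu) * ((8 * khat - 1) / (8 * khat))) :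
  exists2 k : R, 0 < k &
    [/\ (forall X, elastic_strain sy X ->
           pos_differential (sigma_eH mu kappa k khat) X),
        TSTS_Mplus (sigma_eH mu kappa k khat) (elastic_strain sy),
        (forall V, elastic_stretch sy V ->
           pos_differential (sigma_eH mu kappa k khat) (mxlog V))
      & TSTS_Mplus_stretch (sigma_eH mu kappa k khat) (elastic_stretch sy)].
Proof.
exists (2 * (2 / 3 * sy ^+ 2))^-1; first by rewrite invr_gt0; lra.
have pd := sigma_pos hmu hkappa hkhat hsy0 hsy.
have mono : TSTS_Mplus (sigma_eH mu kappa (2 * (2 / 3 * sy ^+ 2))^-1 khat)
    (elastic_strain sy).
  apply: monotone_of_pos_differential => //.
    exact: convex_elastic_strain.
  by move=> X [].
have strain V : elastic_stretch sy V -> elastic_strain sy (mxlog V).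
  by move=> [_ dV]; split=> //; exact: mxlog_sym.
split=> // [V /strain/pd //|V1 V2 hV1 hV2 V12].
apply: mono; [exact: strain|exact: strain|].
by case: hV1 => p1 _; case: hV2 => p2 _ /(mxlog_inj p1 p2).
Qed.
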